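(* For a deterministic control problem on steps $S,\dots,T$ with dynamics $x_{n+1}=f_n(x_n,u_n)$, stage costs $\ell_n$ and terminal cost $\ell_T$, the conditional value functions $V_{k\to i}$ and the value functions $V_k$ (both defined in the context) satisfy, for all states $x_k,x_i$, the following. For all $S\le k<j<i\le T$, $$V_{k\to i}(x_k,x_i)=\min_{x_j}\left\{V_{k\to j}(x_k,x_j)+V_{j\to i}(x_j,x_i)\right\},$$ and for all $S\le k<i\le T$, $$V_k(x_k)=\min_{x_i}\left\{V_{k\to i}(x_k,x_i)+V_i(x_i)\right\}.$$ Here the minimum over $x_j$ (respectively $x_i$) is over the whole state space.
   Context: Let $S<T$ be integers, $\mathcal X$ the state space (typically $\mathbb R^{n_x}$) and $\mathcal U$ the control space (typically $\mathbb R^{n_u}$). For $n=S,\dots,T-1$ let $f_n:\mathcal X\times\mathcal U\to\mathcal X$ and let $\ell_n:\mathcal X\times\mathcal U\to\mathbb R$ be bounded below; let $\ell_T:\mathcal X\to\mathbb R$ be bounded below. The dynamics are $x_{n+1}=f_n(x_n,u_n)$ and the cost of $u_{S:T-1}=(u_S,\dots,u_{T-1})$ is $\ell_T(x_T)+\sum_{n=S}^{T-1}\ell_n(x_n,u_n)$. Value function: $V_T(x_T)=\ell_T(x_T)$ and, for $k=T-1,\dots,S$, $V_k(x_k)=\min_{u_k}\{\ell_k(x_k,u_k)+V_{k+1}(f_k(x_k,u_k))\}$. Conditional value function: for $S\le k<i\le T$, $$V_{k\to i}(x_k,x_i)=\min_{u_{k:i-1}}\sum_{n=k}^{i-1}\ell_n(x_n,u_n)\quad\text{subject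 to } x_n=f_{n-1}(x_{n-1},u_{n-1})\ \ \forall n\in\{k+1,\dots,i\},$$ with the endpoints $x_k,x_i$ prescribed; if no control sequence takes $x_k$ to $x_i$, then $V_{k\to i}(x_k,x_i)=\infty$. Convention: $\min$ is read as the infimum in the extended reals (equal to $+\infty$ over the empty set). *)

(* Defs.v *)
From HB Require Import structures.
From mathcomp Require Import all_boot all_order all_algebra.
From mathcomp Require Import classical_sets boolp reals ereal.
Set Implicit Arguments.
Unset Strict Implicit.
Unset Printing Implicit Defensive.
Import Order.TTheory GRing.Theory Num.Theory.
Local Open Scope classical_set_scope.
Local Open Scope ring_scope.

(* Steps are indexed by [int]. The families [f] and [l] are total in the      *)
(* index; only their values at S, ..., T - 1 are ever used.                   *)

(* Trajectories and control sequences are total functions on [int]; for       *)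
(* k <= i only x_k, ..., x_i and u_k, ..., u_(i-1) are constrained or enter   *)
(* the cost below.                                                            *)
Definition steers (X U : Type) (f : int -> X -> U -> X) (k i : int)
    (xk xi : X) : set ((int -> U) * (int -> X)) :=
  [set ux | [/\ ux.2 k = xk, ux.2 i = xi &
    forall n : int, k + 1 <= n <= i ->
      ux.2 n = f (n - 1) (ux.2 (n - 1)) (ux.1 (n - 1))]].

(* The sum over n = k, ..., i - 1 is indexed by m = n - k. *)
Definition running_cost (R : realType) (X U : Type) (l : int -> X -> U -> R)
    (k i : int) (ux : (int -> U) * (int -> X)) : R :=
  \sum_(m < `|i - k|%N) l (k + m%:Z) (ux.2 (k + m%:Z)) (ux.1 (k + m%:Z)).

(* [ereal_inf set0 = +oo] covers the case where no control sequence takes     *)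
(* [xk] to [xi].                                                              *)
Definition cond_value (R : realType) (X U : Type) (f : int -> X -> U -> X)
    (l : int -> X -> U -> R) (k i : int) (xk xi : X) : \bar R :=
  ereal_inf [set (running_cost l k i ux)%:E | ux in steers f k i xk xi].

(* [value_to_go f l lT T m] is V_(T - m). *)
Fixpoint value_to_go (R : realType) (X U : Type) (f : int -> X -> U -> X)
    (l : int -> X -> U -> R) (lT : X -> R) (T : int) (m : nat) (x : X) : \bar R :=
  if m is m'.+1 then
    let k := T - m%:Z in
    ereal_inf (range (fun u : U =>
      (l k x u)%:E + value_to_go f l lT T m' (f k x u))%E)
  else (lT x)%:E.

(* Meaningful for k <= T, see [valueT] and [value_bellman]. *)
Definition value (R : realType) (X U : Type) (f : int -> X -> U -> X)
    (l : int -> X -> U -> R) (lT : X -> R) (T k : int) (x : X) : \bar R :=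
  value_to_go f l lT T `|T - k|%N x.

Lemma valueT (R : realType) (X U : Type) (f : int -> X -> U -> X)
    (l : int -> X -> U -> R) (lT : X -> R) (T : int) (x : X) :
  value f l lT T T x = (lT x)%:E.
Proof. by rewrite /value subrr. Qed.

Lemma value_bellman (R : realType) (X U : Type) (f : int -> X -> U -> X)
    (l : int -> X -> U -> R) (lT : X -> R) (T k : int) (x : X) :
  k < T ->
  value f l lT T k x =
  ereal_inf (range (fun u : U =>
    (l k x u)%:E + value f l lT T (k + 1) (f k x u))%E).
Proof.
move=> kT; have [m Em] : exists m : nat, T - k = m.+1%:Z.
  move: kT; rewrite -subr_gt0; case: (T - k) => [[|m]|m] // _.
  by exists m.
have Ek : T - m.+1%:Z = k by rewrite -Em opprB addrC subrK.
have Em' : T - (k + 1) = m%:Z by rewrite opprD addrA Em intS addrAC subrr add0r.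
by rewrite /value Em Em' /= Ek.
Qed.

(* Main.v *)
(* Trajectories from k to i are concatenations of trajectories from k to j    *)
(* and from j to i, and the cost is additive; this gives the first identity.  *)
(* The second follows by induction on i - k: the base case i = k + 1 is       *)
(* Bellman's equation with the controls grouped by the state they lead to,    *)
(* and the step combines it, at time i, with the first identity. Lower bounds *)
(* on the costs keep all values above -oo, which is what makes addition       *)
(* commute with infima, since (+oo) + (-oo) = -oo in [\bar R].                *)

Require Import Defs.
From HB Require Import structures.
From mathcomp Require Import all_boot all_order all_algebra.
From mathcomp Require Import classical_sets boolp reals ereal.
From mathcomp Require Import zify.
Import Order.TTheory GRing.Theory Num.Theory.
Local Open Scope classical_set_scope.
Local Open Scope ring_scope.

(** Each identity is proved as two inequalities between infima. In [cond_value_split], gluing two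
    trajectories at a common middle state ([steers_cat]) gives one direction, and cutting a
    trajectory at the state it visits at time [j] gives the other; [running_costD] makes costs add.
    [value_split] is an induction on [i]. For [i = k + 1], Bellman's infimum over controls is
    regrouped by successor state. For larger [i], put [j = i - 1]: both sides equal the infimum over
    [y] and [z] of V_{k->j}(xk,y) + V_{j->i}(y,z) + V_i(z). Moving a summand through an infimum
    ([le_ereal_infDr]) requires quantities above -oo, which [cond_value_gtNy] and [value_gtNy]
    supply. *)

Lemma le_ereal_infDr {R : realType} (A : set (\bar R)) (b c : \bar R) :
  (-oo < ereal_inf A)%E -> (-oo < b)%E ->
  (forall a, A a -> (c <= a + b)%E) -> (c <= ereal_inf A + b)%E.
Proof.
case: b => [r| |] // infA _ cA.
  by rewrite -leeBlDr //; apply: le_ereal_inf_tmp => a Aa; rewrite leeBlDr // cA.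
(* Here [b] is +oo; the sum is +oo only because [ereal_inf A] is not -oo. *)
by rewrite addey ?leey // gt_eqF.
Qed.

Lemma le_ereal_infD {R : realType} (A B : set (\bar R)) (c : \bar R) :
  (-oo < ereal_inf A)%E -> (-oo < ereal_inf B)%E ->
  (forall a b, A a -> B b -> (c <= a + b)%E) ->
  (c <= ereal_inf A + ereal_inf B)%E.
Proof.
move=> infA infB cAB; apply: le_ereal_infDr => // a Aa.
rewrite addeC; apply: le_ereal_infDr => // [|b Bb].
  by apply: (lt_le_trans infA); exact: ereal_inf_lbound.
by rewrite addeC cAB.
Qed.

Lemma running_costD {R : realType} {X U : Type} (l : int -> X -> U -> R)
    (k j i : int) (ux : (int -> U) * (int -> X)) :
  k <= j -> j <= i ->
  running_cost l k i ux = running_cost l k j ux + running_cost l j i ux.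
Proof.
move=> kj ji; rewrite /running_cost.
have -> : `|i - k|%N = (`|j - k| + `|i - j|)%N by lia.
rewrite big_split_ord; congr (_ + _).
apply: eq_bigr => m _ /=.
by have -> : k + (`|j - k| + m)%N%:Z = j + m%:Z by lia.
Qed.

Lemma running_costS {R : realType} {X U : Type} (l : int -> X -> U -> R)
    (k : int) (ux : (int -> U) * (int -> X)) :
  running_cost l k (k + 1) ux = l k (ux.2 k) (ux.1 k).
Proof.
rewrite /running_cost; have -> : `|(k + 1)%R - k|%N = 1%N by lia.
by rewrite big_ord1 addr0.
Qed.

Lemma eq_running_cost {R : realType} {X U : Type} (l : int -> X -> U -> R)
    (k i : int) (ux vy : (int -> U) * (int -> X)) :
  k <= i ->
  (forall n : int, k <= n < i -> ux.1 n = vy.1 n /\ ux.2 n = vy.2 n) ->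
  running_cost l k i ux = running_cost l k i vy.
Proof.
move=> ki e; apply: eq_bigr => m _.
by have [-> ->] := e (k + m%:Z) ltac:(case: m => /=; lia).
Qed.

Lemma steers_sub {X U : Type} (f : int -> X -> U -> X) {k i : int}
    (k' i' : int) {xk xi : X} {ux : (int -> U) * (int -> X)} :
  k <= k' -> i' <= i -> steers f k i xk xi ux ->
  steers f k' i' (ux.2 k') (ux.2 i') ux.
Proof. by move=> kk' ii' [_ _ dyn]; split => // n kn; apply: dyn; lia. Qed.

(* Only the controls strictly before [j] and the states up to [j] come from
   [ux], the rest from [vy]; the two states at [j] agree. *)
Lemma steers_cat {R : realType} {X U : Type} (f : int -> X -> U -> X)
    (l : int -> X -> U -> R) {k j i : int} {xk xj xi : X}
    {ux vy : (int -> U) * (int -> X)} :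
  k <= j -> j <= i -> steers f k j xk xj ux -> steers f j i xj xi vy ->
  exists2 wz, steers f k i xk xi wz &
    running_cost l k i wz = running_cost l k j ux + running_cost l j i vy.
Proof.
move=> kj ji [xkE xjE dynx] [yjE yiE dyny].
pose z n := if n < j then ux.2 n else vy.2 n.
pose w n := if n < j then ux.1 n else vy.1 n.
have zj n : n <= j -> z n = ux.2 n.
  by rewrite /z le_eqVlt => /predU1P[->|->//]; rewrite ltxx yjE xjE.
have zv n : j <= n -> z n = vy.2 n by rewrite /z ltNge => ->.
exists (w, z).
  split; [by rewrite /= zj | by rewrite /= zv |].
  (* The case split is on [n - 1 < j], the time of the control: the transition arriving at [j] still
     belongs to [ux], the one leaving [j] to [vy]. *)
  move=> n kn /=; rewrite /w; case: ltP => nj.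
    by rewrite !zj; [apply: dynx; lia|lia|lia].
  by rewrite !zv; [apply: dyny; lia|lia|lia].
rewrite (running_costD _ _ j) //; congr (_ + _); apply: eq_running_cost => // n.
  by move=> /andP[kn nj] /=; rewrite zj ?(ltW nj) // /w nj.
by move=> /andP[jn _] /=; rewrite zv // /w ltNge jn.
Qed.

Lemma running_cost_lbound {R : realType} {X U : Type} (l : int -> X -> U -> R)
    (k i : int) :
  (forall n : int, k <= n < i ->
     has_lbound [set l n x u | x in [set: X] & u in [set: U]]) ->
  k <= i -> exists M : R, forall ux, M <= running_cost l k i ux.
Proof.
move=> hl ki.
have /choice[b hb] (m : 'I_`|i - k|) : exists b, forall x u, b <= l (k + m%:Z) x u.
  have [b hb] := hl (k + m%:Z) ltac:(case: m => /=; lia).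
  by exists b => x u; apply: hb; exists x => //; exists u.
by exists (\sum_m b m) => ux; apply: ler_sum.
Qed.

Lemma cond_value_gtNy {R : realType} {X U : Type} (f : int -> X -> U -> X)
    (l : int -> X -> U -> R) (k i : int) (xk xi : X) :
  (forall n : int, k <= n < i ->
     has_lbound [set l n x u | x in [set: X] & u in [set: U]]) ->
  k <= i -> (-oo < cond_value f l k i xk xi)%E.
Proof.
move=> hl ki; have [M hM] := running_cost_lbound _ _ _ hl ki.
apply: (lt_le_trans (ltNyr M)); apply: le_ereal_inf_tmp => _ [ux _ <-].
by rewrite lee_fin.
Qed.

Lemma value_gtNy {R : realType} {X U : Type} (f : int -> X -> U -> X)
    (l : int -> X -> U -> R) (lT : X -> R) (T k : int) (x : X) :
  (forall n : int, k <= n < T ->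
     has_lbound [set l n x u | x in [set: X] & u in [set: U]]) ->
  has_lbound (range lT) -> k <= T -> (-oo < value f l lT T k x)%E.
Proof.
move=> hl [M hM] kT.
(* The induction needs a bound uniform in the state: an infimum of values that are each above -oo
   may itself be -oo. *)
suff [b hb] : exists b : R, forall x, (b%:E <= value f l lT T k x)%E.
  exact: lt_le_trans (ltNyr b) (hb x).
have [m mE] : exists m : nat, T - k = m%:Z by exists `|T - k|%N; lia.
elim: m k mE hl kT {x} => [|m IH] k mE hl kT.
  have -> : k = T by lia.
  by exists M => x; rewrite valueT lee_fin; apply: hM; exists x.
have [b hb] := IH (k + 1) ltac:(lia) (fun n kn => hl n ltac:(lia)) ltac:(lia).
have [a ha] := hl k ltac:(lia).
exists (a + b) => x; rewrite value_bellman; last lia.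
apply: le_ereal_inf_tmp => _ [u _ <-]; rewrite EFinD leeD // lee_fin.
by apply: ha; exists x => //; exists u.
Qed.

Lemma cond_value_split {R : realType} {X U : Type} (f : int -> X -> U -> X)
    (l : int -> X -> U -> R) (k j i : int) (xk xi : X) :
  (forall n : int, k <= n < i ->
     has_lbound [set l n x u | x in [set: X] & u in [set: U]]) ->
  k <= j -> j <= i ->
  cond_value f l k i xk xi =
  ereal_inf (range (fun xj : X =>
    cond_value f l k j xk xj + cond_value f l j i xj xi)%E).
Proof.
move=> hl kj ji; apply/eqP; rewrite eq_le; apply/andP; split.
  apply: le_ereal_inf_tmp => _ [xj _ <-]; apply: le_ereal_infD.
  - by apply: cond_value_gtNy => // n kn; apply: hl; lia.
  - by apply: cond_value_gtNy => // n kn; apply: hl; lia.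
  move=> _ _ [ux sux <-] [vy svy <-].
  have [wz swz E] := steers_cat _ l kj ji sux svy.
  by rewrite -EFinD -E; apply: ereal_inf_lbound; exists wz.
apply: le_ereal_inf_tmp => _ [ux sux <-].
(* The middle state is the one that the given trajectory visits at time [j]; its two pieces compete
   in the two conditional values. *)
apply: ge_ereal_inf; exists (cond_value f l k j xk (ux.2 j) +
  cond_value f l j i (ux.2 j) xi)%E; first by exists (ux.2 j).
rewrite (running_costD _ _ j) // EFinD.
have [xkE xiE _] := sux.
apply: leeD; apply: ereal_inf_lbound; exists ux => //.
  by rewrite -{1}xkE; apply: (steers_sub _ _ _ _ _ sux).
by rewrite -{1}xiE; apply: (steers_sub _ _ _ _ _ sux).
Qed.

Lemma value_split {R : realType} {X U : Type} (f : int -> X -> U -> X)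
    (l : int -> X -> U -> R) (lT : X -> R) (T k i : int) (xk : X) :
  (forall n : int, k <= n < T ->
     has_lbound [set l n x u | x in [set: X] & u in [set: U]]) ->
  has_lbound (range lT) -> k < i -> i <= T ->
  value f l lT T k xk =
  ereal_inf (range (fun xi : X =>
    cond_value f l k i xk xi + value f l lT T i xi)%E).
Proof.
move=> hl hlT ki iT.
have vgt n x : k <= n <= T -> (-oo < value f l lT T n x)%E.
  by move=> kn; apply: value_gtNy => //; [move=> p pn; apply: hl|]; lia.
have cgt m n x y : k <= m -> m <= n -> n <= T ->
    (-oo < cond_value f l m n x y)%E.
  by move=> km mn nT; apply: cond_value_gtNy => // p pn; apply: hl; lia.
(* Bellman's equation with controls grouped by the state [y] they lead to; an unreachable [y]
   contributes +oo. *)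
have step n x : k <= n < T -> value f l lT T n x = ereal_inf (range (fun y =>
    cond_value f l n (n + 1) x y + value f l lT T (n + 1) y)%E).
  move=> kn; rewrite value_bellman; last lia.
  apply/eqP; rewrite eq_le; apply/andP; split.
    apply: le_ereal_inf_tmp => _ [y _ <-]; apply: le_ereal_infDr.
    - by apply: cgt; lia.
    - by apply: vgt; lia.
    move=> _ [ux [xE yE dyn] <-]; rewrite running_costS xE.
    apply: ereal_inf_lbound; exists (ux.1 n) => //.
    by rewrite -yE dyn ?addrK ?xE //; lia.
  apply: le_ereal_inf_tmp => _ [u _ <-]; apply: ge_ereal_inf.
  eexists; first by exists (f n x u).
  apply: leeD => //; apply: ereal_inf_lbound.
  (* Only the control at [n] and the states at [n] and [n + 1] matter; the other values are
     arbitrary. *)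
  exists (fun=> u, fun m => if m <= n then x else f n x u) => /=.
    split => /=; [by rewrite lexx | by case: leP => //; lia|].
    move=> m mn; have -> : m = n + 1 by lia.
    by rewrite addrK lexx; case: leP => //; lia.
  by rewrite running_costS /= lexx.
have [m mE] : exists m : nat, i = k + 1 + m%:Z by exists `|(i - k - 1)%R|%N; lia.
elim: m i mE ki iT => [|m IH] i mE ki iT.
  by have -> : i = k + 1 by [lia]; apply: step; lia.
pose j := k + 1 + m%:Z.
have iE : i = j + 1 by rewrite /j; lia.
(* With [k] fixed, the last step from [j] to [i] is split off, leaving an exchange of the infima
   over the states at [j] and at [i]. *)
rewrite (IH j) //; [|by rewrite /j; lia..].
apply/eqP; rewrite eq_le; apply/andP; split.
  apply: le_ereal_inf_tmp => _ [z _ <-].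
  rewrite (cond_value_split _ _ _ j); last first.
  - by lia.
  - by lia.
  - by move=> n kn; apply: hl; lia.
  apply: le_ereal_infDr.
  (* The infimum over the state at [j] is folded back into V_{k->i} to see that it exceeds -oo. *)
  - rewrite -cond_value_split; [apply: cgt| |..]; try lia.
    by move=> n kn; apply: hl; lia.
  - by apply: vgt; lia.
  move=> _ [y _ <-]; rewrite -addeA; apply: ge_ereal_inf.
  eexists; first by exists y.
  apply: leeD => //; rewrite step; last lia.
  by rewrite -iE; apply: ereal_inf_lbound; exists z.
apply: le_ereal_inf_tmp => _ [y _ <-]; rewrite addeC.
rewrite step; last lia; apply: le_ereal_infDr.
- by rewrite -step; [apply: vgt; lia|lia].
- by apply: cgt; lia.
move=> _ [z _ <-]; rewrite -iE; apply: ge_ereal_inf.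
eexists; first by exists z.
rewrite [leRHS]addeC addeA; apply: leeD => //.
rewrite (cond_value_split _ _ _ j); [|by move=> n kn; apply: hl; lia|lia|lia].
by apply: ereal_inf_lbound; exists y.
Qed.

Theorem theorem2 (R : realType) (X U : Type) (S T : int) (hST : S < T)
    (f : int -> X -> U -> X) (l : int -> X -> U -> R) (lT : X -> R)
    (hl : forall n : int, S <= n < T ->
      has_lbound [set l n x u | x in [set: X] & u in [set: U]])
    (hlT : has_lbound (range lT)) :
  (forall (k j i : int) (xk xi : X), S <= k -> k < j -> j < i -> i <= T ->
     cond_value f l k i xk xi =
     ereal_inf (range (fun xj : X =>
       cond_value f l k j xk xj + cond_value f l j i xj xi)%E)) /\
  (forall (k i : int) (xk : X), S <= k -> k < i -> i <= T ->
     value f l lT T k xk =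
     ereal_inf (range (fun xi : X =>
       cond_value f l k i xk xi + value f l lT T i xi)%E)).
Proof.
split=> [k j i xk xi Sk kj ji iT|k i xk Sk ki iT].
  apply: cond_value_split; [|exact: ltW..].
  by move=> n kn; apply: hl; lia.
by apply: value_split => // n kn; apply: hl; lia.
Qed.
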